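(* Let $\mathcal B=(X,Y,Z)$ be a bilinear triple of Banach spaces, let $f\in G([a,b],X)$ (i.e. $f:[a,b]\to X$ is regulated) and let $g:[a,b]\to Y$. Let $E$ be an elementary set in $[a,b]$, let $T$ be a closed subset of $E$, and suppose $$[a,b]\setminus T=\bigcup_{i\in\mathbb N}E_i,$$ where $E_i$, $i\in\mathbb N$, are mutually disjoint elementary sets in $[a,b]$. Put $S_n=\bigcup_{i=1}^nE_i$ for $n\in\mathbb N$. Assume that the integral $\int_E[\mathrm df]\,g$ exists and that the sequence $\{g\chi_{S_n}\}_{n\in\mathbb N}$ is equi-integrable with respect to $f$ on $[a,b]$. Then the integral $\int_T[\mathrm df]\,g$ exists.
   Context: $[a,b]$ is a fixed compact interval in $\mathbb R$, $a<b$. A bilinear triple $\mathcal B=(X,Y,Z)$ consists of Banach spaces $X,Y,Z$ together with a bilinear map $B:X\times Y\to Z$, written $xy:=B(x,y)$, such that $\|xy\|_Z\le\beta\|x\|_X\|y\|_Y$ for some $\beta\in[0,\infty)$ (without loss of generality $\beta=1$). A function $f:[a,b]\to X$ is regulated ($f\in G([a,b],X)$) if it has a one-sided limit in $X$ from the right at each point of $[a,b)$ and from the left at each point of $(a,b]$. An elementary set is a finite union of mutually disjoint bounded intervals in $\mathbb R$. A gauge on $[a,b]$ is a function $\delta:[a,b]\to(0,\infty)$. A tagged partition $P=\{([\alpha_{j-1},\alpha_j],\xi_j)\}_{j=1}^m$ of $[a,b]$ consists of $a=\alpha_0<\alpha_1<\dots<\alpha_m=b$ and $\xi_j\in[\alpha_{j-1},\alpha_j]$;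 it is $\delta$-fine if $[\alpha_{j-1},\alpha_j]\subset(\xi_j-\delta(\xi_j),\xi_j+\delta(\xi_j))$ for all $j$. For $f:[a,b]\to X$, $g:[a,b]\to Y$ put $S(\mathrm df,g,P)=\sum_{j=1}^m[f(\alpha_j)-f(\alpha_{j-1})]\,g(\xi_j)$. The Kurzweil-Stieltjes integral $\int_a^b[\mathrm df]\,g$ exists and equals $I\in Z$ if for every $\varepsilon>0$ there is a gauge $\delta$ on $[a,b]$ such that $\|S(\mathrm df,g,P)-I\|_Z<\varepsilon$ for every $\delta$-fine partition $P$ of $[a,b]$. For an arbitrary set $M\subset[a,b]$ with characteristic function $\chi_M$, $\int_M[\mathrm df]\,g:=\int_a^b[\mathrm df]\,(g\chi_M)$ whenever the right-hand side exists. A sequence $\{g_n\}$ of functions $[a,b]\to Y$ is equi-integrable with respect to $f:[a,b]\to X$ on $[a,b]$ if $\int_a^b[\mathrm df]\,g_n$ exists for all $n\in\mathbb N$ and for every $\eta>0$ there is a gauge $\delta$ on $[a,b]$ such that $\big\|S(\mathrm df,g_n,P)-\int_a^b[\mathrm df]\,g_n\big\|_Z<\eta$ for every $\delta$-fine partition $P$ of $[a,b]$ and every $n\in\mathbb N$. *)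

(* Defs.v *)
From HB Require Import structures.
From mathcomp Require Import all_boot all_order all_algebra.
From mathcomp Require Import all_classical all_reals all_analysis.

Set Implicit Arguments.
Unset Strict Implicit.
Unset Printing Implicit Defensive.

Import Order.TTheory GRing.Theory Num.Theory.
Import numFieldNormedType.Exports.

Local Open Scope classical_set_scope.
Local Open Scope ring_scope.

(* Functions on [a, b] are represented by total functions on R; every notion
   below depends only on their values on [a, b]. *)

Section RegulatedElementary.
Variable R : realType.

Definition regulated (X : normedModType R) (a b : R) (f : R -> X) : Prop :=
  (forall t, a <= t < b -> cvg (f x @[x --> t^'+])) /\
  (forall t, a < t <= b -> cvg (f x @[x --> t^'-])).

(* Intervals may be open, closed, half-open, degenerate or empty. *)
Definition elementary_set (E : set R) : Prop :=
  exists (m : nat) (J : 'I_m -> set R),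
    [/\ forall i, is_interval (J i) /\ bounded_set (J i),
        trivIset setT J &
        E = \bigcup_i J i].

Definition elementary_set_in (a b : R) (E : set R) : Prop :=
  elementary_set E /\ E `<=` `[a, b].

End RegulatedElementary.

Section TaggedPartitions.
Variable R : realType.

Definition gauge (a b : R) (delta : R -> R) : Prop :=
  forall x, x \in `[a, b] -> 0 < delta x.

(* [points] lists alpha_1 < ... < alpha_m = b, without alpha_0 = a, as in
   [itv_partition]; [tags] lists xi_1, ..., xi_m.  Counting from 0, the j-th
   subinterval is [(a :: points)`_j, points`_j] and its tag is tags`_j. *)
Record tagged_partition (a b : R) := TaggedPartition {
  points : seq R;
  tags : seq R;
  points_itv_partition : itv_partition a b points;
  size_tags : size tags = size points;
  tags_in : forall j, (j < size points)%N ->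
    (a :: points)`_j <= tags`_j <= points`_j
}.

Definition fine_partition (a b : R) (delta : R -> R)
    (P : tagged_partition a b) : Prop :=
  forall j, (j < size (points P))%N ->
    let xi := (tags P)`_j in
    `[(a :: points P)`_j, (points P)`_j] `<=`
      `]xi - delta xi, xi + delta xi[.

End TaggedPartitions.

Section KurzweilStieltjes.
Variables (R : realType) (X Y Z : normedModType R).
Variables (B : {bilinear X -> Y -> Z}) (a b : R).

Definition KS_sum (f : R -> X) (g : R -> Y) (P : tagged_partition a b) : Z :=
  \sum_(j < size (points P))
    B (f (points P)`_j - f (a :: points P)`_j) (g (tags P)`_j).

Definition is_KS_integral (f : R -> X) (g : R -> Y) (I : Z) : Prop :=
  forall eps : R, 0 < eps -> exists delta : R -> R, gauge a b delta /\
    forall P : tagged_partition a b, fine_partition delta P ->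
      `|KS_sum f g P - I| < eps.

Definition KS_integrable (f : R -> X) (g : R -> Y) : Prop :=
  exists I : Z, is_KS_integral f g I.

(* The value of the integral when it exists, and 0 otherwise. *)
Definition KS_integral (f : R -> X) (g : R -> Y) : Z :=
  xget 0 [set I | is_KS_integral f g I].

Definition mul_indic (g : R -> Y) (M : set R) : R -> Y :=
  fun x => (\1_M x : R) *: g x.

Definition KS_integrable_on (M : set R) (f : R -> X) (g : R -> Y) : Prop :=
  KS_integrable f (mul_indic g M).

Definition equi_integrable (f : R -> X) (g_ : nat -> R -> Y) : Prop :=
  (forall n, KS_integrable f (g_ n)) /\
  forall eta : R, 0 < eta -> exists delta : R -> R, gauge a b delta /\
    forall P : tagged_partition a b, fine_partition delta P ->
      forall n, `|KS_sum f (g_ n) P - KS_integral f (g_ n)| < eta.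

End KurzweilStieltjes.

(* Main.v *)
Require Import Defs.
From mathcomp Require Import all_boot all_order all_algebra.
From mathcomp Require Import all_classical all_reals all_analysis.
From mathcomp Require Import lra.

Import Order.TTheory GRing.Theory Num.Theory.
Import numFieldNormedType.Exports.

Local Open Scope classical_set_scope.
Local Open Scope ring_scope.

(* The Riemann sums of g chi_{S_n} and of g over [a, b] minus T agree on any
   given partition as soon as n is large, since only finitely many tags occur;
   equi-integrability therefore makes the Riemann sums of g chi_{[a,b] \ T}
   satisfy the Cauchy criterion.  Multiplication by the indicator of an
   elementary set preserves integrability: intervals are differences of lower
   sets of R, and for a lower set one cuts [a, b] at its supremum c, where the
   only correction is a jump term, controlled by the one-sided limits of f.
   Finally chi_T = chi_E - chi_E chi_{[a,b] \ T}. *)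

(** * Fine partitions as lists, Cousin's lemma, and the filter generated by gauges *)

Section FineSteps.
Set Implicit Arguments.
Unset Strict Implicit.
Variable R : realType.
Implicit Types (u v w c x : R) (d : R -> R) (l : seq (R * R)).

(* A partition of [u, v] is encoded as the list of the pairs (right end point,
   tag) of its subintervals. *)
Fixpoint fine_steps d u l v : bool :=
  if l is p :: l' then
    [&& u < p.1, u <= p.2 <= p.1, p.2 - d p.2 < u, p.1 < p.2 + d p.2
      & fine_steps d p.1 l' v]
  else u == v.

Lemma fine_steps_le d u l v : fine_steps d u l v -> u <= v.
Proof.
elim: l u => [|[w x] l IH] u /=; first by move=> /eqP ->.
by move=> /and5P[uw _ _ _ /IH]; apply: le_trans (ltW uw).
Qed.

Lemma fine_steps_sub d d' u l v : (forall x, d x <= d' x) ->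
  fine_steps d u l v -> fine_steps d' u l v.
Proof.
move=> dd'; elim: l u => [//|[w x] l IH] u /= /and5P[-> -> xu wx /IH ->].
have := dd' x; rewrite /= andbT => dx; apply/andP; split; lra.
Qed.

Lemma eq_fine_steps d d' u l v : (forall x, u <= x <= v -> d x = d' x) ->
  fine_steps d u l v -> fine_steps d' u l v.
Proof.
elim: l u => [//|[w x] l IH] u /= dd' /and5P[uw uxw xu wx fl].
have wv := fine_steps_le fl.
have dx : d x = d' x by apply: dd'; lra.
rewrite uw uxw -dx xu wx /=; apply: IH fl => y wyv; apply: dd'; lra.
Qed.

Lemma fine_steps_cat d u l w l' v :
  fine_steps d u l w -> fine_steps d w l' v -> fine_steps d u (l ++ l') v.
Proof.
elim: l u => [|[y x] l IH] u /=; first by move=> /eqP ->.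
by move=> /and5P[-> -> -> ->] /= /IH; apply.
Qed.

(** The supremum [c] of the end points reachable from [u] is reached by a step tagged at [c]; if
    [c < v], such a step could even end beyond [c]. *)
Lemma cousin d u v : u <= v -> (forall x, 0 < d x) ->
  exists l, fine_steps d u l v.
Proof.
move=> uv d0.
pose A := [set x | u <= x <= v /\ exists l, fine_steps d u l x].
have Au : A u by split; [rewrite lexx|exists [::] => /=].
have Aub : ubound A v by move=> x [/andP[]].
have supA : has_sup A by split; [exists u|exists v].
pose c := sup A.
have uc : u <= c by apply: sup_upper_bound.
have cv : c <= v by apply: ge_sup => //; exists u.
have dc := d0 c.
have [x [xuv [l fl]] cx] : exists2 x, A x & c - d c < x.
  by apply: sup_gt; [exists u|rewrite -/c; lra].
have xc : x <= c by apply: sup_upper_bound => //; split=> //; exists l.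
(* The added step from [x] to [w] has tag [c], since [c - d c < x <= c <= w < c + d c]. *)
have extend w : c <= w -> w <= v -> w < c + d c -> A w.
  move=> cw wv wc; split; first lra.
  have [xw|xw] := ltP x w; last first.
    by exists l; have <- : x = w by lra.
  exists (l ++ [:: (w, c)]); apply: fine_steps_cat fl _ => /=.
  by rewrite xw xc cw cx wc /=.
have [cv'|vc] := ltP c v; last first.
  by have -> : v = c by [lra]; have [] := extend c (lexx _) cv ltac:(lra).
have : A (Num.min v (c + d c / 2)).
  by apply: extend; rewrite ?le_min ?ge_min ?gt_min ?lexx //; lra.
by move=> /(sup_upper_bound supA); rewrite -/c ge_min => /orP[]; lra.
Qed.

(* A gauge bounded by |x - c| away from c forces c to be a tag, so every fine
   partition can be cut at c without changing Riemann sums. *)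
Definition pinned c d := forall x, x != c -> d x <= `|x - c|.

(** For [x != c] the open interval of radius [d x] around [x] misses [c]. *)
Lemma pinned_tag c d u w x : pinned c d -> u <= c <= w ->
  x - d x < u -> w < x + d x -> x = c.
Proof.
move=> pd ucw xu wx; apply/eqP; apply: contraT => /pd.
by case: (ger0P (x - c)) => ? ?; lra.
Qed.

(** Integrals become limits of Riemann sums along this filter, so that the Cauchy criterion and the
    algebra of limits apply. *)
Definition fine_filter u v : set_system (seq (R * R)) :=
  [set A | exists2 d : R -> R, (forall x, 0 < d x) &
           forall l, fine_steps d u l v -> A l].

Lemma fine_filter_proper u v : u <= v -> ProperFilter (fine_filter u v).
Proof.
move=> uv; split.
  by move=> [d d0]; have [l fl] := cousin uv d0; apply; exact: fl.
split; first by exists (fun=> 1).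
- move=> P Q [d d0 dP] [e e0 eQ]; exists (fun x => Num.min (d x) (e x)).
    by move=> x; rewrite lt_min d0 e0.
  move=> l fl; split.
    by apply: dP; apply: fine_steps_sub fl => x; rewrite ge_min lexx.
  by apply: eQ; apply: fine_steps_sub fl => x; rewrite ge_min lexx orbT.
- by move=> P Q PQ [d d0 dP]; exists d => // l /dP /PQ.
Qed.

Lemma fine_filter_pinned u v c (e : R) : 0 < e -> fine_filter u v
  [set l | exists d, [/\ pinned c d, d c <= e & fine_steps d u l v]].
Proof.
move=> e0; pose d x := if x == c then e else `|x - c|.
exists d => [x|l fl].
  by rewrite /d; case: eqVneq => // xc; rewrite normr_gt0 subr_eq0.
exists d; split=> //; first by move=> x /negPf xc; rewrite /d xc.
by rewrite /d eqxx.
Qed.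

(** By convexity, the inclusion of a subinterval in the open interval around its tag amounts to the
    two end-point inequalities of [fine_steps]. *)
Lemma fine_steps_zip d u s t v : size t = size s ->
  fine_steps d u (zip s t) v <->
  itv_partition u v s /\ forall j, (j < size s)%N ->
    (u :: s)`_j <= t`_j <= s`_j /\
    `[(u :: s)`_j, s`_j] `<=` `]t`_j - d t`_j, t`_j + d t`_j[.
Proof.
elim: s t u => [|w s IH] [|x t] u //=.
  by split=> [uv|[[_]]] //; split.
move=> [/IH {}IH]; split.
  move=> /and5P[uw uxw xu wx /IH[[ps ls] H]]; split.
    by split; rewrite //= uw.
  move=> [_|j /H//]; split=> // y /=; rewrite !in_itv /=; lra.
move=> [[/= /andP[uw ps] ls] H].
have [/= -> sub] := H 0%N isT.
rewrite uw /=; apply/and3P; split.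
- have /sub : u \in `[u, w] by rewrite in_itv /= lexx ltW.
  by rewrite /= in_itv => /andP[].
- have /sub : w \in `[u, w] by rewrite in_itv /= lexx ltW.
  by rewrite /= in_itv => /andP[].
- by apply/IH; split=> [|j js]; [split|apply: (H j.+1)].
Qed.

End FineSteps.

(** * Riemann-Stieltjes sums over lists, the Cauchy criterion, additivity in the interval *)

Section StepSums.
Set Implicit Arguments.
Unset Strict Implicit.
Variables (R : realType) (X Y Z : completeNormedModType R).
Variables (B : {bilinear X -> Y -> Z}) (f : R -> X).
Implicit Types (u v w c x : R) (d : R -> R) (l : seq (R * R)) (g h k : R -> Y).

Fixpoint KS_steps g u l : Z :=
  if l is p :: l' then B (f p.1 - f u) (g p.2) + KS_steps g p.1 l' else 0.

Lemma KS_steps_cat g d u l w l' : fine_steps d u l w ->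
  KS_steps g u (l ++ l') = KS_steps g u l + KS_steps g w l'.
Proof.
elim: l u => [|[y x] l IH] u /=; first by move=> /eqP ->; rewrite add0r.
by move=> /and5P[_ _ _ _ /IH ->]; rewrite addrA.
Qed.

Lemma KS_stepsB g h u l :
  KS_steps (g \- h) u l = KS_steps g u l - KS_steps h u l.
Proof.
elim: l u => [|[w x] l IH] u /=; first by rewrite subrr.
by rewrite IH linearBr opprD addrACA.
Qed.

Lemma eq_KS_steps {g h d u l v} : fine_steps d u l v ->
  (forall x, u <= x <= v -> g x = h x) -> KS_steps g u l = KS_steps h u l.
Proof.
elim: l u => [//|[w x] l IH] u /= /and5P[uw uxw _ _ fl] gh.
have wv := fine_steps_le fl.
rewrite gh; last lra.
by congr (_ + _); apply: IH fl _ => y wyv; apply: gh; lra.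
Qed.

(** A step with [c] strictly inside is tagged by [c]; cutting it there keeps the tag, and additivity
    of [B] in its first argument preserves the sum. *)
Lemma KS_steps_split d u l v c : pinned c d -> u <= c <= v ->
  fine_steps d u l v ->
  exists l1 l2, [/\ fine_steps d u l1 c, fine_steps d c l2 v &
    forall g, KS_steps g u l = KS_steps g u l1 + KS_steps g c l2].
Proof.
move=> pd; elim: l u => [|[w x] l IH] u ucv.
  by move=> /= uv; exists [::], [::]; split=> [||g] /=; [lra|lra|rewrite addr0].
have [->{ucv}|uc] := eqVneq u c.
  by exists [::], ((w, x) :: l); split=> //= g; rewrite add0r.
move=> /= /and5P[uw uxw xu wx fl].
have wv := fine_steps_le fl.
have [wc|cw|wc] := ltgtP w c.
- have [|l1 [l2 [f1 f2 H]]] := IH w _ fl; first lra.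
  exists ((w, x) :: l1), l2; split=> [|//|g] /=; first by rewrite uw uxw xu wx.
  by rewrite H addrA.
- have xc : x = c by apply: pinned_tag pd _ xu wx; lra.
  subst x; exists [:: (c, c)], ((w, c) :: l); split=> [||g] /=.
  + by rewrite eqxx; lra.
  + by rewrite fl; lra.
  + by rewrite addr0 addrA -linearDl [_ + (f w - _)]addrC subrKA.
- subst w; exists [:: (c, x)], l; split=> [|//|g] /=; last by rewrite addr0.
  by rewrite uw uxw xu wx /=.
Qed.

Definition steps_integrable u v g :=
  cvg (KS_steps g u l @[l --> fine_filter u v]).

(** Completeness of [Z]. As [z] may vary with [eps], a single Riemann sum can stand in for the
    unknown integral. *)
Lemma steps_integrable_cauchy u v g : u <= v ->
  (forall eps : R, 0 < eps -> exists z,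
     \forall l \near fine_filter u v, `|z - KS_steps g u l| < eps) ->
  steps_integrable u v g.
Proof.
move=> uv H; have PF := fine_filter_proper uv.
apply/cauchy_cvgP; apply: cauchy_exP => eps eps0.
have [z zP] := H _ eps0; exists z; apply: filterS zP => l.
by rewrite -ball_normE.
Qed.

Lemma eq_steps_integrable u v g h : u <= v ->
  (forall x, u <= x <= v -> g x = h x) ->
  steps_integrable u v g -> steps_integrable u v h.
Proof.
move=> uv gh; have PF := fine_filter_proper uv.
move=> /cvg_ex[I gI]; apply/cvg_ex; exists I.
apply: cvg_trans gI; apply: near_eq_cvg.
by exists (fun=> 1) => // l fl; exact: eq_KS_steps fl gh.
Qed.

Lemma steps_integrableB u v g h : u <= v ->
  steps_integrable u v g -> steps_integrable u v h ->
  steps_integrable u v (g \- h).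
Proof.
move=> uv gI hI; have PF := fine_filter_proper uv.
rewrite /steps_integrable; under eq_fun do rewrite KS_stepsB.
exact: is_cvgB.
Qed.

(** Appending the same fine partition of [[c, v]] to two partitions of [[u, c]] keeps the difference
    of their sums, and both extended sums are close to the integral over [[u, v]]. *)
Lemma steps_integrable_left u c v g : u <= c -> c <= v ->
  steps_integrable u v g -> steps_integrable u c g.
Proof.
move=> uc cv /cvg_ex[I gI]; apply: steps_integrable_cauchy => // eps eps0.
have PF := fine_filter_proper (le_trans uc cv).
have e20 : 0 < eps / 2 by lra.
have [d d0 dP] := (cvgrPdist_lt _ _).1 gI _ e20.
have [l0 fl0] := cousin uc d0; have [l2 fl2] := cousin cv d0.
exists (KS_steps g u l0), d => // l fl.
have P0 := dP _ (fine_steps_cat fl0 fl2).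
have P1 := dP _ (fine_steps_cat fl fl2).
rewrite /= (KS_steps_cat _ _ fl0) in P0.
rewrite /= (KS_steps_cat _ _ fl) in P1.
rewrite -(addrKA (KS_steps g c l2)) (le_lt_trans (ler_distD I _ _))//.
rewrite (splitr eps) ltrD //; first by rewrite distrC.
by rewrite (addrC _ (KS_steps g u l)).
Qed.

Lemma steps_integrable_glue u c v g : u <= c -> c <= v ->
  steps_integrable u c g -> steps_integrable c v g -> steps_integrable u v g.
Proof.
move=> uc cv /cvg_ex[I gI] /cvg_ex[J gJ].
have uv := le_trans uc cv.
have PF := fine_filter_proper uv.
have PF1 := fine_filter_proper uc.
have PF2 := fine_filter_proper cv.
apply/cvg_ex; exists (I + J); apply/cvgrPdist_lt => eps eps0.
have e20 : 0 < eps / 2 by lra.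
have [d d0 dP] := (cvgrPdist_lt _ _).1 gI _ e20.
have [e e0 eP] := (cvgrPdist_lt _ _).1 gJ _ e20.
pose m x := Num.min (d x) (e x).
have m0 x : 0 < m x by rewrite lt_min d0 e0.
(* Besides refining both gauges, [q] is pinned at [c], so every [q]-fine partition can be split
   there. *)
pose q x := if x == c then m x else Num.min (m x) `|x - c|.
have qm x : q x <= m x by rewrite /q; case: eqP => // _; rewrite ge_min lexx.
exists q => [x|l fl].
  rewrite /q; case: eqVneq => // xc.
  by rewrite lt_min m0 normr_gt0 subr_eq0.
have pq : pinned c q.
  by move=> x /negPf xc; rewrite /q xc ge_min lexx orbT.
have [|l1 [l2 [f1 f2 /= ->]]] := KS_steps_split pq _ fl.
  by rewrite uc cv.
rewrite opprD addrACA (le_lt_trans (ler_normD _ _))// (splitr eps) ltrD//.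
- apply: dP; apply: fine_steps_sub f1 => x.
  by rewrite (le_trans (qm x))// ge_min lexx.
- apply: eP; apply: fine_steps_sub f2 => x.
  by rewrite (le_trans (qm x))// ge_min lexx orbT.
Qed.

(** * Equivalence with the integral over tagged partitions *)

Lemma KS_steps_zip g u s t : size t = size s ->
  \sum_(j < size s) B (f s`_j - f (u :: s)`_j) (g t`_j) =
  KS_steps g u (zip s t).
Proof.
elim: s t u => [|w s IH] [|x t] u //=; first by rewrite big_ord0.
by move=> [/IH {}IH]; rewrite big_ord_recl /= -IH.
Qed.

Lemma near_fine_partition a b d : gauge a b d ->
  \forall l \near fine_filter a b, exists2 P : tagged_partition a b,
    fine_partition d P & forall g, KS_sum B f g P = KS_steps g a l.
Proof.
(* A [gauge] is positive only on [[a, b]], while the filter asks for positivity everywhere; the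
   value 1 fills in outside. *)
move=> d0; exists (fun x => if x \in `[a, b] then d x else 1).
  by move=> x; case: ifP => // /d0.
move=> l; rewrite -(zip_unzip l).
have sz : size (unzip2 l) = size (unzip1 l) by rewrite !size_map.
move: (unzip1 l) (unzip2 l) sz => s t sz fl.
have {}fl : fine_steps d a (zip s t) b.
  by apply: eq_fine_steps fl => x axb; rewrite in_itv /= axb.
have [ps H] := (fine_steps_zip d a b sz).1 fl.
exists (TaggedPartition ps sz (fun j js => (H j js).1)).
  by move=> j js; exact: (H j js).2.
by move=> g; exact: KS_steps_zip.
Qed.

Lemma is_KS_integralP a b g I : a <= b ->
  is_KS_integral B a b f g I <->
  KS_steps g a l @[l --> fine_filter a b] --> I.
Proof.
move=> ab; have PF := fine_filter_proper ab; split.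
  move=> gI; apply/cvgrPdist_lt => eps /gI[d [d0 dP]].
  have := near_fine_partition d0; apply: filterS => l [P /dP + PE].
  by rewrite PE distrC.
move=> /cvgrPdist_lt gI eps /gI[d d0 dP]; exists d; split=> // P Pd.
rewrite distrC /KS_sum KS_steps_zip ?size_tags//; apply: dP.
apply/fine_steps_zip; first exact: size_tags.
split=> [|j js]; first exact: points_itv_partition.
by split; [exact: tags_in|exact: Pd].
Qed.

Lemma KS_integrableP a b g : a <= b ->
  KS_integrable B a b f g <-> steps_integrable a b g.
Proof.
move=> ab; split=> [[I /(is_KS_integralP _ _ ab) gI]|/cvg_ex[I gI]].
  by apply/cvg_ex; exists I.
by exists I; apply/is_KS_integralP.
Qed.

(** * Pointwise eventually constant limits of equi-integrable sequences *)

Lemma near_eq_KS_steps (g_ : nat -> R -> Y) g d u l v :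
  (forall x, u <= x <= v -> \forall n \near \oo, g_ n x = g x) ->
  fine_steps d u l v ->
  \forall n \near \oo, KS_steps (g_ n) u l = KS_steps g u l.
Proof.
elim: l u => [|[w x] l IH] u gg /=; first by move=> _; exact: nearW.
move=> /and5P[uw uxw _ _ fl]; have wv := fine_steps_le fl.
have gx : \forall n \near \oo, g_ n x = g x by apply: gg; lra.
have gl : \forall n \near \oo, KS_steps (g_ n) w l = KS_steps g w l.
  by apply: IH fl => y wyv; apply: gg; lra.
by near=> n; congr (B _ _ + _); near: n.
Unshelve. all: by end_near. Qed.

Lemma equi_integrable_limit a b (g_ : nat -> R -> Y) g : a <= b ->
  equi_integrable B a b f g_ ->
  (forall x, a <= x <= b -> \forall n \near \oo, g_ n x = g x) ->
  steps_integrable a b g.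
Proof.
move=> ab [_ equi] gg; have PF := fine_filter_proper ab.
apply: steps_integrable_cauchy => // eps eps0.
have [d [d0 dP]] := equi _ (divr_gt0 eps0 (ltr0Sn _ 1)).
(* The gauge 1 merely records that [l] partitions [[a, b]], so that its tags lie where [g_] is
   eventually [g]. *)
have near_sums : \forall l \near fine_filter a b, fine_steps (fun=> 1) a l b /\
    forall n, `|KS_steps (g_ n) a l - KS_integral B a b f (g_ n)| < eps / 2.
  apply: filterI; first by exists (fun=> 1).
  have := near_fine_partition d0; apply: filterS => l [P /dP + PE] n.
  by move=> /(_ n); rewrite PE.
have [l0 [fl0 l0P]] := filter_ex near_sums.
exists (KS_steps g a l0); apply: filterS near_sums => l [fl lP].
(* The index [n] may depend on [l0] and [l], because the gauge [d] serves every [n]. *)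
have [n [<- <-]] : exists n, KS_steps (g_ n) a l0 = KS_steps g a l0 /\
    KS_steps (g_ n) a l = KS_steps g a l.
  apply: (@filter_ex _ \oo); apply: filterI; first exact: near_eq_KS_steps fl0.
  exact: near_eq_KS_steps fl.
rewrite (le_lt_trans (ler_distD (KS_integral B a b f (g_ n)) _ _))//.
by rewrite (splitr eps) ltrD// distrC.
Qed.

(** * Jump terms: integrands vanishing on one side of a point *)

Variable beta : R.
Hypothesis beta_ge0 : 0 <= beta.
Hypothesis B_bounded : forall (x : X) (y : Y), `|B x y| <= beta * `|x| * `|y|.

Lemma cvg_bilinearl (T : Type) (F : set_system T) (FF : Filter F)
    (p : T -> X) (x : X) (y : Y) :
  p t @[t --> F] --> x -> B (p t) y @[t --> F] --> B x y.
Proof.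
move=> px; apply/cvgrPdist_lt => eps eps0.
pose M := beta * `|y| + 1.
have M0 : 0 < M by rewrite ltr_wpDl // mulr_ge0.
have e0 : 0 < eps / M by rewrite divr_gt0.
move/cvgrPdist_lt: px => /(_ _ e0); apply: filterS => t /= tP.
rewrite -linearBl (le_lt_trans (B_bounded _ _))// mulrAC.
rewrite (@le_lt_trans _ _ (M * `|x - p t|))// ?ler_wpM2r// /M ?lerDl//.
by rewrite mulrC -ltr_pdivlMr.
Qed.

(** Pinning forces the first tag to be [c]; all later tags lie beyond [c], where [k] vanishes. *)
Lemma KS_steps_right k d c l v : pinned c d ->
  (forall x, c < x -> k x = 0) -> fine_steps d c l v -> c < v ->
  exists w, c < w < c + d c /\ KS_steps k c l = B (f w - f c) (k c).
Proof.
move=> pd k0; have tail w l' : c < w -> fine_steps d w l' v ->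
    KS_steps k w l' = 0.
  elim: l' w => [//|[w' x] l' IH] w cw /= /and5P[ww' wxw _ _ fl].
  by rewrite k0 ?linear0r ?add0r; [apply: IH fl; lra|lra].
case: l => [|[w x] l] /=; first by lra.
move=> /and5P[cw cxw xc wx fl] _.
have xE : x = c by apply: pinned_tag pd _ xc wx; lra.
subst x; exists w; rewrite (tail w l)// addr0; split=> //; lra.
Qed.

Lemma KS_steps_left k d u l c : pinned c d ->
  (forall x, x < c -> k x = 0) -> fine_steps d u l c -> u < c ->
  exists w, c - d c < w < c /\ KS_steps k u l = B (f c - f w) (k c).
Proof.
move=> pd k0; elim: l u => [|[w x] l IH] u /=; first by lra.
move=> /and5P[uw uxw xu wx fl] uc.
have wc := fine_steps_le fl.
move: wc; rewrite le_eqVlt => /orP[/eqP wc|wc].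
  subst w; have xE : x = c by apply: pinned_tag pd _ xu wx; lra.
  subst x; exists u; split; first lra.
  (* No step can follow one that ends at [c], the right end of the interval. *)
  case: l fl {IH} => [|[w' x'] l] /=; first by rewrite addr0.
  by move=> /and5P[cw _ _ _ /fine_steps_le wc]; exfalso; lra.
have [w' [w'P ->]] := IH w fl wc.
by exists w'; split=> //; rewrite k0 ?linear0r ?add0r//; lra.
Qed.

(** Each sum is one jump term at [c], whose free end point [w] is driven to [c] from the right by
    shrinking the gauge at [c]. *)
Lemma steps_integrable_at_right k c v : c <= v ->
  (c < v -> cvg (f x @[x --> c^'+])) ->
  (forall x, c < x -> k x = 0) -> steps_integrable c v k.
Proof.
move=> cv fc k0; have PF := fine_filter_proper cv.
have [cv'|vc] := ltP c v; last first.
  apply: steps_integrable_cauchy => // eps eps0; exists 0, (fun=> 1) => //.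
  case=> [|[w x] l] /=; first by rewrite subrr normr0.
  by move=> /and5P[cw _ _ _ /fine_steps_le wc]; exfalso; lra.
have /cvg_ex[L fL] := fc cv'.
have jump : B (f w - f c) (k c) @[w --> c^'+] --> B (L - f c) (k c).
  by apply: cvg_bilinearl; apply: cvgB fL _; exact: cvg_cst.
apply/cvg_ex; exists (B (L - f c) (k c)); apply/cvgrPdist_lt => eps eps0.
move/cvgrPdist_lt: jump => /(_ _ eps0).
rewrite near_withinE => /nbhs_ballP[e /= e0 eP].
have := fine_filter_pinned c v c e0; apply: filterS => l [d [pd dc fl]].
have [w [wP ->]] := KS_steps_right pd k0 fl cv'.
have cw : ball c e w by rewrite -ball_normE /= ltr0_norm; lra.
by apply: eP cw _; lra.
Qed.

Lemma steps_integrable_at_left k u c : u <= c ->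
  (u < c -> cvg (f x @[x --> c^'-])) ->
  (forall x, x < c -> k x = 0) -> steps_integrable u c k.
Proof.
move=> uc fc k0; have PF := fine_filter_proper uc.
have [uc'|cu] := ltP u c; last first.
  apply: steps_integrable_cauchy => // eps eps0; exists 0, (fun=> 1) => //.
  case=> [|[w x] l] /=; first by rewrite subrr normr0.
  by move=> /and5P[cw _ _ _ /fine_steps_le wc]; exfalso; lra.
have /cvg_ex[L fL] := fc uc'.
have jump : B (f c - f w) (k c) @[w --> c^'-] --> B (f c - L) (k c).
  by apply: cvg_bilinearl; apply: cvgB fL; exact: cvg_cst.
apply/cvg_ex; exists (B (f c - L) (k c)); apply/cvgrPdist_lt => eps eps0.
move/cvgrPdist_lt: jump => /(_ _ eps0).
rewrite near_withinE => /nbhs_ballP[e /= e0 eP].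
have := fine_filter_pinned u c c e0; apply: filterS => l [d [pd dc fl]].
have [w [wP ->]] := KS_steps_left pd k0 fl uc'.
have wc : ball c e w by rewrite -ball_normE /= gtr0_norm; lra.
by apply: eP wc _; lra.
Qed.

(** * Sets whose indicator preserves integrability *)

Variables a b : R.
Hypothesis ab : a <= b.
Hypothesis f_regulated : regulated a b f.

Definition preserves_integrability (D : set R) := forall h,
  steps_integrable a b h -> steps_integrable a b (mul_indic h D).

Lemma mul_indic_in h (D : set R) x : D x -> mul_indic h D x = h x.
Proof. by move=> Dx; rewrite /mul_indic indicE mem_set// scale1r. Qed.

Lemma mul_indic_out h (D : set R) x : ~ D x -> mul_indic h D x = 0.
Proof. by move=> Dx; rewrite /mul_indic indicE memNset// scale0r. Qed.

Lemma lower_set_cut (D : set R) : (forall x y, x <= y -> D y -> D x) ->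
  exists2 c, a <= c <= b & (forall x, x < c -> a <= x -> D x) /\
    (forall x, c < x -> x <= b -> ~ D x).
Proof.
(* Adjoining [a] makes [A] nonempty and gives [a <= sup A] even if [D] misses [[a, b]]. *)
move=> Dlow; pose A := a |` (D `&` `[a, b]).
have Aa : A a by left.
have Aub : ubound A b by move=> x [->//|[_]] /=; rewrite in_itv /= => /andP[].
have supA : has_sup A by split; [exists a|exists b].
exists (sup A).
  apply/andP; split; first exact: sup_upper_bound.
  by apply: ge_sup => //; exists a.
split=> x.
  move=> xc ax; have [|y [->|[Dy _]] xy] := sup_gt _ xc; first by exists a.
    by lra.
  exact: Dlow (ltW xy) Dy.
move=> cx xb Dx.
have ac : a <= sup A by exact: sup_upper_bound.
have : x <= sup A.
  by apply: sup_upper_bound => //; right; split=> //=; rewrite in_itv /=; lra.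
lra.
Qed.

Lemma preserves_integrability_lower (D : set R) :
  (forall x y, x <= y -> D y -> D x) -> preserves_integrability D.
Proof.
move=> /lower_set_cut[c /andP[ac cb] [Dl Dr]] h hI.
have [fr fl] := f_regulated.
(* The restricted integrand is [h - k] on [[a, c]] and [k'] on [[c, b]]. On these intervals [k] and
   [k'] can be nonzero only at [c], whether or not [c] lies in [D]. *)
pose k x := if x < c then 0 else h x - mul_indic h D x.
pose k' x := if c < x then 0 else mul_indic h D x.
apply: (@steps_integrable_glue _ c) => //.
  apply: (@eq_steps_integrable _ _ (h \- k)) => //.
    move=> x /andP[ax xc]; rewrite /= /k; case: ltP => cx.
      by rewrite subr0 mul_indic_in//; apply: Dl.
    by rewrite subKr.
  apply: steps_integrableB => //; first exact: steps_integrable_left hI.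
  apply: steps_integrable_at_left => // [ac'|x]; first by apply: fl; lra.
  by rewrite /k => ->.
apply: (@eq_steps_integrable _ _ k') => //.
  move=> x /andP[cx xb]; rewrite /= /k'; case: ltP => // cx'.
  by rewrite mul_indic_out//; apply: Dr.
apply: steps_integrable_at_right => // [cb'|x]; first by apply: fr; lra.
by rewrite /k' => ->.
Qed.

(** The restricted integrand is $h\chi_D-(h\chi_D)\chi_{D'}$, and [D'] is applied to the integrand
    $h\chi_D$. *)
Lemma preserves_integrabilityD (D D' : set R) :
  preserves_integrability D -> preserves_integrability D' ->
  preserves_integrability (D `\` D').
Proof.
move=> PD PD' h hI; have h1 := PD _ hI; have h2 := PD' _ h1.
apply: eq_steps_integrable (steps_integrableB ab h1 h2) => // x _ /=.
rewrite /mul_indic !indicE in_setD.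
by case: (x \in D); case: (x \in D');
  rewrite /= ?scale1r ?scale0r ?subrr ?subr0.
Qed.

Lemma preserves_integrabilityT : preserves_integrability setT.
Proof.
by move=> h; apply: eq_steps_integrable => // x _; rewrite mul_indic_in.
Qed.

Lemma preserves_integrability0 : preserves_integrability set0.
Proof.
rewrite -(setDv setT); apply: preserves_integrabilityD;
exact: preserves_integrabilityT.
Qed.

Lemma preserves_integrabilityU (D D' : set R) :
  preserves_integrability D -> preserves_integrability D' ->
  preserves_integrability (D `|` D').
Proof.
(* The union is written as $\mathbb R\setminus((\mathbb R\setminus D)\setminus D')$, leaving only
   differences. *)
move=> PD PD'; rewrite -[_ `|` _]setCK setCU -setDE -!setTD.
apply: (preserves_integrabilityD preserves_integrabilityT).
apply: (preserves_integrabilityD _ PD').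
exact: (preserves_integrabilityD preserves_integrabilityT PD).
Qed.

(** [D] is the lower closure of [J] and [D'] its part strictly below [J]; both are lower sets, so
    all kinds of intervals are treated alike. *)
Lemma preserves_integrability_itv (J : set R) :
  is_interval J -> preserves_integrability J.
Proof.
move=> Jitv.
pose D := [set x | exists2 y, J y & x <= y].
pose D' := [set x | D x /\ forall y, J y -> x < y].
have -> : J = D `\` D'.
  apply/seteqP; split=> x /=.
    move=> Jx; split; first by exists x.
    by move=> [_ /(_ x Jx)]; rewrite ltxx.
  move=> [Dx nD']; have [y Jy xy] := Dx.
  have [z Jz zx] : exists2 z, J z & z <= x.
    apply: contrapT => nz; apply: nD'; split=> // z Jz.
    by rewrite ltNge; apply/negP => zx; apply: nz; exists z.
  by apply: Jitv Jz Jy _ _; rewrite zx xy.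
apply: preserves_integrabilityD; apply: preserves_integrability_lower.
  by move=> x y xy [z Jz yz]; exists z => //; exact: le_trans yz.
move=> x y xy [[z Jz yz] yJ]; split.
  by exists z => //; exact: le_trans yz.
by move=> t /yJ; exact: le_lt_trans.
Qed.

Lemma preserves_integrability_elementary (E : set R) :
  elementary_set E -> preserves_integrability E.
Proof.
move=> [m [J [Jitv _ ->]]].
have -> : \bigcup_i J i = \big[setU/set0]_(i <- index_enum 'I_m) J i.
  rewrite -bigcup_seq; apply: eq_bigcupl; split=> // i _ /=; exact: mem_index_enum.
apply: big_ind => [|D D'|i _]; first exact: preserves_integrability0.
  exact: preserves_integrabilityU.
by apply: preserves_integrability_itv; case: (Jitv i).
Qed.

End StepSums.

Theorem theorem5p6 (R : realType) (a b : R) (hab : a < b)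
  (X Y Z : completeNormedModType R) (B : {bilinear X -> Y -> Z})
  (beta : R) (hbeta : 0 <= beta)
  (hB : forall x y, `|B x y| <= beta * `|x| * `|y|)
  (f : R -> X) (hf : regulated a b f) (g : R -> Y)
  (E T : set R) (hE : elementary_set_in a b E)
  (hT : closed T) (hTE : T `<=` E)
  (E_ : nat -> set R)
  (hE_ : forall i, elementary_set_in a b (E_ i))
  (hE_disj : trivIset setT E_)
  (hcompl : `[a, b] `\` T = \bigcup_i E_ i)
  (hint : KS_integrable_on B a b E f g)
  (hequi : equi_integrable B a b f
             (fun n => mul_indic g (\bigcup_(i < n.+1) E_ i))) :
  KS_integrable_on B a b T f g.
Proof.
have ab := ltW hab.
apply/KS_integrableP => //.
have gE : steps_integrable B f a b (mul_indic g E) by apply/KS_integrableP.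
(* A point of [E_ i] lies in the partial unions for all [n >= i]; at uncovered points every term is
   0. *)
have gS : steps_integrable B f a b (mul_indic g (\bigcup_i E_ i)).
  apply: equi_integrable_limit hequi _ => // x _.
  have [[i _ xi]|nx] := pselect ((\bigcup_i E_ i) x).
    near=> n; rewrite !mul_indic_in//; first by exists i.
    by exists i => //=; near: n; exact: nbhs_infty_ge.
  apply: nearW => n; rewrite !mul_indic_out// => -[i _ xi].
  by apply: nx; exists i.
(* Restricting further to the elementary set [E] gives integrability of [g] over $E\setminus T$. *)
have gSE := preserves_integrability_elementary hbeta hB ab hf hE.1 gS.
apply: eq_steps_integrable (steps_integrableB ab gE gSE) => // x axb /=.
(* On [T] the subtracted term is 0 and $T\subset E$ leaves [g x]; off [T] the two terms cancel. *)
have [xT|xT] := pselect (T x).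
  have nS : ~ (\bigcup_i E_ i) x by rewrite -hcompl => -[].
  have xE := hTE _ xT.
  rewrite !(mul_indic_in _ xE) (mul_indic_in _ xT).
  by rewrite (mul_indic_out _ nS) subr0.
have xS : (\bigcup_i E_ i) x by rewrite -hcompl; split=> //=; rewrite in_itv.
rewrite [RHS]mul_indic_out//.
by rewrite /mul_indic !indicE (mem_set xS) scale1r subrr.
Unshelve. all: by end_near. Qed.
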